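(* Let $\langle A,\prec\rangle$ be an S4-subordination algebra and let $\langle X,\tau\rangle$ be the Stone space of $A$ (so $X=\mathrm{Ul}(A)$). Then the family $S=\{\beta({\downarrow}a):a\in A\}$ is a base, closed under finite intersections, for a topology $\tau_S$ on $X$ such that $\langle X,\tau,\tau_S\rangle$ is an S4-subordination space. Moreover, for all $a,b\in A$, $$a\prec b\quad\text{if and only if}\quad \varphi(a)\prec_S\varphi(b).$$
   Context: A subordination on a Boolean algebra $A$ is a binary relation $\prec$ on $A$ such that: (S1) $0\prec 0$ and $1\prec 1$; (S2) $a\prec b$ and $a\prec c$ imply $a\prec b\wedge c$; (S3) $a\prec c$ and $b\prec c$ imply $a\vee b\prec c$; (S4) $a\leq b\prec c\leq d$ implies $a\prec d$. The pair $\langle A,\prec\rangle$ is an S4-subordination algebra if moreover (S5) $a\prec b$ implies $a\leq b$, and (S6) $a\prec b$ implies that there is $c\in A$ with $a\prec c\prec b$. Write ${\downarrow}a=\{b\in A:b\prec a\}$, which is an ideal of $A$. $\mathrm{Ul}(A)$ is the set of ultrafilters of $A$; $\varphi(a)=\{x\in \mathrm{Ul}(A):a\in x\}$; the Stone space of $A$ is $\mathrm{Ul}(A)$ with the topology $\tau$ having base $\{\varphi(a):a\in A\}$. For an ideal $I$ of $A$, $\beta(I)=\{x\in \mathrm{Ul}(A): I\cap x\neq\emptyset\}$. Let $\langle X,\tau,\tau_S\rangle$ be a bitopological space (a set with two topologies). $\mathrm{Clop}(X)$ denotes the Boolean algebra of clopen subsets of $\langle X,\tau\rangle$; $\mathrm{int}_S$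 denotes interior with respect to $\tau_S$. For $U,V\in\mathrm{Clop}(X)$, $U\prec_S V$ means $U\subseteq\mathrm{int}_S(V)$. For $x,y\in X$: $x\leq_S y$ iff for all $U\in\mathrm{Clop}(X)$, $x\in\mathrm{int}_S(U)$ implies $y\in\mathrm{int}_S(U)$; $x\triangleleft_S y$ iff for all $U\in\mathrm{Clop}(X)$, $x\in\mathrm{int}_S(U)$ implies $y\in U$. The space is an S4-subordination space if: (Sp1) $\langle X,\tau\rangle$ is a Stone space; (Sp2) $\{\mathrm{int}_S(U):U\in\mathrm{Clop}(X)\}$ is a base for $\tau_S$; (Sp3) $\mathrm{int}_S(U)\in\tau$ for each $U\in\mathrm{Clop}(X)$; (Sp4) $\triangleleft_S\subseteq\leq_S$. *)

(* Defs.v *)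
From HB Require Import structures.
From mathcomp Require Import all_boot all_order.
From mathcomp Require Import boolp classical_sets functions cardinality.
From mathcomp Require Import topology.

Set Implicit Arguments.
Unset Strict Implicit.
Unset Printing Implicit Defensive.

Import Order.TTheory.
Local Open Scope classical_set_scope.

(* Boolean algebras are the complemented distributive lattices with bottom and
   top, [ctbDistrLatticeType]; the one-element algebra is not excluded. *)

Record subordination (d : Order.disp_t) (A : ctbDistrLatticeType d)
    (prec : A -> A -> Prop) : Prop := Subordination {
  sub_bot : prec \bot%O \bot%O;
  sub_top : prec \top%O \top%O;
  sub_meet : forall a b c, prec a b -> prec a c -> prec a (b `&` c)%O;
  sub_join : forall a b c, prec a c -> prec b c -> prec (a `|` b)%O c;
  sub_le_prec_le : forall a b c e,
    (a <= b)%O -> prec b c -> (c <= e)%O -> prec a e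
}.

Record S4_subordination (d : Order.disp_t) (A : ctbDistrLatticeType d)
    (prec : A -> A -> Prop) : Prop := S4Subordination {
  S4_sub : subordination prec;
  S4_le : forall a b, prec a b -> (a <= b)%O;
  S4_interp : forall a b, prec a b -> exists2 c, prec a c & prec c b
}.

Definition prec_down (d : Order.disp_t) (A : ctbDistrLatticeType d)
  (prec : A -> A -> Prop) (a : A) : set A := [set b | prec b a].

Section StoneSpaceOfAlgebra.
Context {d : Order.disp_t} (A : ctbDistrLatticeType d).

Record proper_lattice_filter (F : set A) : Prop := ProperLatticeFilter {
  plf_top : F \top%O;
  plf_up : forall a b, (a <= b)%O -> F a -> F b;
  plf_meet : forall a b, F a -> F b -> F (a `&` b)%O;
  plf_proper : ~ F \bot%O
}.

Definition ultrafilter (F : set A) : Prop :=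
  proper_lattice_filter F /\
  forall G : set A, proper_lattice_filter G -> F `<=` G -> G = F.

Definition Ul : Type := set_type [set F : set A | ultrafilter F].
HB.instance Definition _ := Choice.on Ul.

Definition uset (x : Ul) : set A := \val x.

Definition phi (a : A) : set Ul := [set x | uset x a].

Definition beta (I : set A) : set Ul := [set x | I `&` uset x !=set0].

Lemma uset_plf (x : Ul) : proper_lattice_filter (uset x).
Proof. by have /set_mem[] := valP x. Qed.

Lemma phi_cover : \bigcup_(U in range phi) id U = setT.
Proof.
apply/seteqP; split=> // x _; exists (phi \top%O); first by exists \top%O.
exact: plf_top (uset_plf x).
Qed.

Lemma phi_join (U V : set Ul) (x : Ul) :
  range phi U -> range phi V -> id U x -> id V x ->
  exists W, [/\ range phi W, id W x & id W `<=` id U `&` id V].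
Proof.
move=> [a _ <-] [b _ <-] xa xb; exists (phi (a `&` b)%O); split.
- by exists (a `&` b)%O.
- exact: plf_meet (uset_plf x) _ _ xa xb.
- by move=> y yab; split; apply: (plf_up (uset_plf y) _ yab);
    rewrite ?leIl ?leIr.
Qed.

HB.instance Definition _ := isBaseTopological.Build Ul phi_cover phi_join.

End StoneSpaceOfAlgebra.

Arguments Ul {d} A.

(* The library attaches a single topology to a type. In a bitopological space
   the topology tau is the library structure on X, and the second one is an
   explicit family of open sets; [alt_space tauS] is X carrying tauS. *)
Record topology (X : Type) : Type := Topology {
  topen : set (set X);
  topenT : topen setT;
  topenI : setI_closed topen;
  topen_bigU : forall (I : Type) (f : I -> set X),
    (forall i, topen (f i)) -> topen (\bigcup_i f i)
}.

Definition alt_space (X : choiceType) (tauS : topology X) : Type := X.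

HB.instance Definition _ (X : choiceType) (tauS : topology X) :=
  Choice.on (alt_space tauS).
HB.instance Definition _ (X : choiceType) (tauS : topology X) :=
  isOpenTopological.Build (alt_space tauS)
    (topenT tauS) (@topenI X tauS) (@topen_bigU X tauS).

Definition stone_space (X : topologicalType) : Prop :=
  [/\ compact [set: X], hausdorff_space X & basis (@clopen X)].

Section Bitopological.
Context {X : topologicalType} (tauS : topology X).

Definition int_S (U : set X) : set X := @interior (alt_space tauS) U.

(* A relation on Clop(X): it never holds outside the clopen sets of tau. *)
Definition prec_S (U V : set X) : Prop :=
  [/\ clopen U, clopen V & U `<=` int_S V].

Definition le_S (x y : X) : Prop :=
  forall U : set X, clopen U -> int_S U x -> int_S U y.

Definition tri_S (x y : X) : Prop :=
  forall U : set X, clopen U -> int_S U x -> U y.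

Record S4_subordination_space : Prop := S4SubordinationSpace {
  Sp1 : stone_space X;
  Sp2 : @basis (alt_space tauS) [set int_S U | U in @clopen X];
  Sp3 : forall U : set X, clopen U -> open (int_S U);
  Sp4 : forall x y : X, tri_S x y -> le_S x y
}.

End Bitopological.

(* Main.v *)
Require Import Defs.
From HB Require Import structures.
From mathcomp Require Import all_boot all_order.
From mathcomp Require Import boolp classical_sets functions cardinality.
From mathcomp Require Import topology.

Local Open Scope classical_set_scope.

Import Order.Theory.

(** The engine of the proof is one form of the prime ideal theorem: if [I] is
    an ideal of [A] and [phi a `<=` beta I], then [I a] ([phi_sub_beta]).
    Otherwise [a] and the complements of the members of [I] generate a proper
    filter, which extends to an ultrafilter containing [a] and missing [I].

    Stone duality comes out of it by choosing the ideal. The principal ideal of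
    [b] shows that [phi] reflects the order ([phi_sub]). The ideal of the [a]
    whose [phi a] is negligible for a set filter without cluster point shows
    that [Ul A] is compact ([compact_Ul]). For a clopen [U], the [c] such that
    [U] has a trace of the form [phi a] on [phi c] form an ideal met by every
    ultrafilter, hence containing [\top], so that [U] itself is some [phi a]
    ([clopen_phi]).

    On the side of the subordination, write [S] for the family of the sets
    [beta (prec_down prec a)]. It is closed under finite intersections: the
    conditions on meets make [beta (prec_down prec (a `&` b))] the intersection
    of the sets for [a] and [b], and [prec \top \top] puts the whole space in
    [S]. Hence [S] is a base for the topology made of its unions.
    The central fact is that the interior of [phi a] for that topology is
    [beta (prec_down prec a)] ([int_S_phi]). Interpolation is what makes it
    true: if [x] contains [c] with [prec c b], and [beta (prec_down prec b)]
    lies in [phi a], take [e] with [prec c e] and [prec e b]; then [phi e] is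
    contained in [beta (prec_down prec b)], so that [e <= a] and [prec c a].
    Since clopen sets are the [phi a], the axioms of an S4-subordination space
    become statements about [S], and the condition [phi a `<=` int_S (phi b)]
    reads [phi a `<=` beta (prec_down prec b)], which is [prec a b] by the prime
    ideal theorem for the ideal [prec_down prec b]. *)

(** * Bases of topologies *)

Lemma basis_nbhsP {T : topologicalType} {B : set (set T)} : basis B ->
  forall x V, nbhs x V <-> exists U, [/\ B U, U x & U `<=` V].
Proof.
move=> [Bopen Bnbhs] x V; split=> [/Bnbhs[U [BU Ux] UV]|[U [BU Ux UV]]].
  by exists U.
by apply: (filterS UV); apply: open_nbhs_nbhs; split=> //; exact: Bopen.
Qed.

Lemma basisP (T : topologicalType) (B : set (set T)) : B `<=` open ->
  (forall x V, open V -> V x -> exists U, [/\ B U, U x & U `<=` V]) -> basis B.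
Proof.
move=> Bopen Bsub; split=> // x V; rewrite nbhsE => -[W [Wo Wx] WV].
by have [U [BU Ux UW]] := Bsub x W Wo Wx; exists U => //; apply: subset_trans WV.
Qed.

Lemma finite_bigcap_closed (T : Type) (B : set (set T)) :
  B setT -> setI_closed B ->
  forall F : set (set T), finite_set F -> F `<=` B -> B (\bigcap_(U in F) U).
Proof.
move=> BT BI F /finite_setP[n]; elim: n F => [|n IH] F.
  by rewrite II0 card_eq0 => /eqP ->; rewrite bigcap_set0.
move=> /eq_cardSP[U FU FUn] FB; rewrite -(setD1K FU) bigcap_setU1.
by apply: BI; [exact: FB|apply: IH => // V [/FB]].
Qed.

Section TopologyOfBase.
Context {X : choiceType} {B : set (set X)}.
Hypotheses (BT : B setT) (BI : setI_closed B).

Definition base_open : set (set X) :=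
  [set V | forall x, V x -> exists U, [/\ B U, U x & U `<=` V]].

Lemma base_openT : base_open setT.
Proof. by move=> x _; exists setT. Qed.

Lemma base_openI : setI_closed base_open.
Proof.
move=> V W Vo Wo x [/Vo[P [BP Px PV]] /Wo[Q [BQ Qx QW]]].
by exists (P `&` Q); split=> //; [exact: BI|exact: setISS].
Qed.

Lemma base_open_bigU (I : Type) (f : I -> set X) :
  (forall i, base_open (f i)) -> base_open (\bigcup_i f i).
Proof.
move=> fo x [i _ /fo[U [BU Ux Uf]]]; exists U; split=> //.
by move=> y /Uf; exists i.
Qed.

Definition base_topology : topology X :=
  Topology base_openT base_openI base_open_bigU.

Lemma base_topology_basis : @basis (alt_space base_topology) B.
Proof.
apply: basisP => [U BU|x V Vo]; last exact: (Vo : base_open V).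
suff : base_open U by [].
by move=> x Ux; exists U; split.
Qed.

End TopologyOfBase.

(** * Ultrafilters and the prime ideal theorem *)

Section StoneDuality.
Context {d : Order.disp_t} {A : ctbDistrLatticeType d}.

Record ideal (I : set A) : Prop := Ideal {
  ideal_bot : I \bot%O;
  ideal_down : forall a b, (a <= b)%O -> I b -> I a;
  ideal_join : forall a b, I a -> I b -> I (a `|` b)%O
}.

(** Zorn's lemma is applied to the sets [G] for which [F `|` G] is a proper
    filter, rather than to the filters above [F], so that the empty chain needs
    no special treatment. *)
Lemma proper_filter_ultra {F : set A} : proper_lattice_filter F ->
  exists x : Ul A, F `<=` uset x.
Proof.
move=> plF; pose P (G : set A) := proper_lattice_filter (F `|` G).
have [|M [PM Mmax]] := @Zorn_bigcup A P.
  move=> C CP Ctot.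
  (* The filter axioms involve at most two members, hence one proper filter. *)
  have common a b : (F `|` \bigcup_(G in C) G) a ->
      (F `|` \bigcup_(G in C) G) b ->
      exists Z, [/\ P Z, (F `|` Z) a, (F `|` Z) b &
                 Z `<=` \bigcup_(G in C) G].
    move=> [Fa|[G CG Ga]] [Fb|[H CH Hb]].
    - by exists set0; split; rewrite /P ?setU0.
    - exists H; split; [exact: CP|by left|by right|exact: bigcup_sup].
    - exists G; split; [exact: CP|by right|by left|exact: bigcup_sup].
    - have [GH|HG] := Ctot _ _ CG CH.
      + by exists H; split; [exact: CP|right; exact: GH|right|exact: bigcup_sup].
      + by exists G; split; [exact: CP|right|right; exact: HG|exact: bigcup_sup].
  split.
  - by left; exact: plf_top plF.
  - move=> a b ab Ca; have [Z [PZ Za _ ZC]] := common _ _ Ca Ca.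
    by have [Fb|/ZC Cb] := plf_up PZ ab Za; [left|right].
  - move=> a b Ca Cb; have [Z [PZ Za Zb ZC]] := common _ _ Ca Cb.
    by have [Fab|/ZC Cab] := plf_meet PZ Za Zb; [left|right].
  - move=> C0; have [Z [PZ Z0 _ _]] := common _ _ C0 C0.
    exact: plf_proper PZ Z0.
have uM : [set G : set A | ultrafilter G] (F `|` M).
  split=> // G plG FMG; apply/seteqP; split=> //.
  have /setUidPr FG : F `<=` G by move=> a Fa; apply: FMG; left.
  have MG : M `<=` G by move=> a Ma; apply: FMG; right.
  have [GM a Ga|nGM] := pselect (G `<=` M); first by right; exact: GM.
  by case: (Mmax G); [split|rewrite /P FG].
by exists (SigSub (mem_set uM)) => a Fa; left.
Qed.

Lemma ultra_compl (x : Ul A) a : uset x (~` a)%O <-> ~ uset x a.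
Proof.
have plx := uset_plf x; split=> [xNa xa|nxa].
  by apply: (plf_proper plx); rewrite -(meetxC a); exact: plf_meet.
(* If [~` a] were not in [x], then [x] and [a] would generate a proper filter,
   equal to [x] by maximality. *)
apply: contrapT => nxNa; apply: nxa.
pose G := [set c | exists2 e, uset x e & (e `&` a <= c)%O].
have plG : proper_lattice_filter G.
  split.
  - by exists \top%O; [exact: plf_top|rewrite lex1].
  - by move=> b c bc [e xe eab]; exists e => //; exact: le_trans bc.
  - move=> b c [e xe eab] [f xf fac]; exists (e `&` f)%O; first exact: plf_meet.
    rewrite lexI (le_trans _ eab) ?(le_trans _ fac) //.
      by rewrite leI2 // leIr.
    by rewrite leI2 // leIl.
  - move=> [e xe]; rewrite lex0 disj_leC => eNa.
    by apply: nxNa; exact: plf_up eNa xe.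
have /set_mem[_ xmax] := valP x.
have <- : G = uset x.
  by apply: xmax plG _ => e xe; exists e => //; rewrite leIl.
by exists \top%O; [exact: plf_top|rewrite meet1x].
Qed.

Lemma phi_compl (a : A) : phi (~` a)%O = ~` phi a.
Proof. by apply/seteqP; split=> x /ultra_compl. Qed.

Lemma phi_meet (a b : A) : phi (a `&` b)%O = phi a `&` phi b.
Proof.
apply/seteqP; split=> x; last by case; exact: plf_meet (uset_plf x) _ _.
by move=> xab; split; apply: (plf_up (uset_plf x) _ xab); rewrite ?leIl ?leIr.
Qed.

Lemma phi_joinE (a b : A) : phi (a `|` b)%O = phi a `|` phi b.
Proof.
by apply: setC_inj; rewrite setCU -!phi_compl complU phi_meet.
Qed.

Lemma phi_top : phi (\top%O : A) = setT.
Proof. by apply/seteqP; split=> // x _; exact: plf_top (uset_plf x). Qed.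

Lemma phi_bot : phi (\bot%O : A) = set0.
Proof. by rewrite -compl1 phi_compl phi_top setCT. Qed.

Lemma phi_sub_beta {I : set A} : ideal I -> forall a, phi a `<=` beta I -> I a.
Proof.
move=> idI a aI; apply: contrapT => nIa.
pose F := [set c | exists2 e, I e & (a `&` ~` e <= c)%O].
have plF : proper_lattice_filter F.
  split.
  - by exists \bot%O; [exact: ideal_bot|rewrite lex1].
  - by move=> b c bc [e Ie aeb]; exists e => //; exact: le_trans bc.
  - move=> b c [e Ie aeb] [f If afc]; exists (e `|` f)%O; first exact: ideal_join.
    rewrite complU lexI (le_trans _ aeb) ?(le_trans _ afc) //.
      by rewrite leI2 // leIr.
    by rewrite leI2 // leIl.
  - move=> [e Ie]; rewrite lex0 disj_leC complK => ae.
    by apply: nIa; exact: ideal_down ae Ie.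
have [x Fx] := proper_filter_ultra plF.
have [|e [Ie xe]] := aI x.
  by apply: Fx; exists \bot%O; [exact: ideal_bot|rewrite leIl].
suff /ultra_compl : uset x (~` e)%O by [].
by apply: Fx; exists e => //; rewrite leIr.
Qed.

Lemma ideal_cover {I : set A} : ideal I -> beta I = setT -> I \top%O.
Proof. by move=> idI IT; apply: phi_sub_beta => //; rewrite IT. Qed.

Lemma phi_sub (a b : A) : phi a `<=` phi b -> (a <= b)%O.
Proof.
move=> ab; apply: (@phi_sub_beta [set c | c <= b]%O); last first.
  by move=> x /ab xb; exists b; split=> /=.
split=> /= [|c e ce /(le_trans ce)//|c e cb eb]; first exact: le0x.
by rewrite leUx cb.
Qed.

(** * The Stone space *)

Lemma phi_open (a : A) : open (phi a).
Proof. by exists [set phi a]; [move=> _ ->; exists a|rewrite bigcup_set1]. Qed.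

Lemma phi_clopen (a : A) : clopen (phi a).
Proof.
split; first exact: phi_open.
by rewrite -[phi a]setCK -phi_compl; apply: open_closedC; exact: phi_open.
Qed.

Lemma open_phi {U : set (Ul A)} {x : Ul A} :
  open U -> U x -> exists2 a, phi a x & phi a `<=` U.
Proof.
move=> [D Dphi <-] [V DV Vx]; have [a _ aV] := Dphi V DV.
by exists a; rewrite aV //; exact: bigcup_sup.
Qed.

Lemma compact_Ul : compact [set: Ul A].
Proof.
move=> F PF _; apply: contrapT => nclF.
pose I := [set a | F (~` phi a)].
have idI : ideal I.
  split.
  - by rewrite /I /= phi_bot setC0; exact: filterT.
  - move=> a b ab; apply: filterS; apply: subsetC => x.
    exact: plf_up (uset_plf x) _ _ ab.
  - by move=> a b Ia Ib; rewrite /I /= phi_joinE setCU; exact: filterI.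
suff /ideal_cover : beta I = setT.
  by move=> /(_ idI); rewrite /I /= phi_top setCT; exact: filter_not_empty.
apply/seteqP; split=> // x _; apply: contrapT => nIx.
apply: nclF; exists x; split=> // P Q FP; rewrite nbhsE => -[W [Wo Wx] WQ].
have [a xa aW] := open_phi Wo Wx.
apply: contrapT => nPQ; apply: nIx; exists a; split=> //.
by apply: filterS FP => y Py ya; apply: nPQ; exists y; split=> //; exact/WQ/aW.
Qed.

Lemma hausdorff_Ul : hausdorff_space (Ul A).
Proof.
have sub (x y : Ul A) : cluster (nbhs x) y -> uset x `<=` uset y.
  move=> xy a xa; apply: contrapT => nya.
  have yNa := (ultra_compl y a).2 nya.
  have phi_nbhs (b : A) (z : Ul A) : uset z b -> nbhs z (phi b).
    by move=> zb; apply: open_nbhs_nbhs; split=> //; exact: phi_open.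
  have [z [za zNa]] := xy _ _ (phi_nbhs _ _ xa) (phi_nbhs _ _ yNa).
  exact: (ultra_compl z a).1 zNa za.
move=> x y xy; apply: val_inj; have /set_mem[_ xmax] := valP x.
by apply/esym/xmax; [exact: uset_plf|exact: sub].
Qed.

Lemma stone_Ul : stone_space (Ul A).
Proof.
split; [exact: compact_Ul|exact: hausdorff_Ul|].
apply: basisP => [U []//|x V Vo Vx].
by have [a xa aV] := open_phi Vo Vx; exists (phi a); split=> //; exact: phi_clopen.
Qed.

(** The [c] on which [U] has a trace of the form [phi a] form an ideal; openness
    of [U] and of its complement makes every ultrafilter meet this ideal. *)
Lemma clopen_phi {U : set (Ul A)} : clopen U -> exists a, U = phi a.
Proof.
move=> [Uo Uc]; pose I := [set c | exists a, phi c `&` U = phi a].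
have idI : ideal I.
  split.
  - by exists \bot%O; rewrite phi_bot set0I.
  - move=> b c bc [a ca]; exists (b `&` a)%O.
    by rewrite phi_meet -ca setIA -phi_meet (meet_l bc).
  - move=> b c [a ba] [e ce]; exists (a `|` e)%O.
    by rewrite !phi_joinE setIUl ba ce.
have [|a] := ideal_cover idI; last by rewrite phi_top setTI => ->; exists a.
apply/seteqP; split=> // x _; have [Ux|nUx] := pselect (U x).
  have [c xc cU] := open_phi Uo Ux.
  by exists c; split=> //; exists c; exact/setIidl.
have [c xc cU] := open_phi (closed_openC Uc) nUx.
exists c; split=> //; exists \bot%O; rewrite phi_bot.
exact/disjoints_subset.
Qed.

End StoneDuality.

(** * The topology of a subordination *)

Section Subordination.
Context {d : Order.disp_t} {A : ctbDistrLatticeType d}.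
Context {prec : A -> A -> Prop} (hA : S4_subordination prec).

Local Notation hS := (S4_sub hA).
Local Notation down := (prec_down prec).

Definition down_base : set (set (Ul A)) := [set beta (down a) | a in [set: A]].

Lemma prec_ler a b c : prec a b -> (b <= c)%O -> prec a c.
Proof. exact: (sub_le_prec_le hS (lexx a)). Qed.

Lemma prec_lel a b c : (a <= b)%O -> prec b c -> prec a c.
Proof. by move=> ab bc; apply: (sub_le_prec_le hS ab bc). Qed.

Lemma down_ideal a : ideal (down a).
Proof.
split=> [|b c|b c]; [|exact: prec_lel|exact: sub_join hS _ _ _].
exact: prec_ler (sub_bot hS) (le0x a).
Qed.

Lemma beta_downT : beta (down \top%O) = setT.
Proof.
apply/seteqP; split=> // x _; exists \top%O; split; first exact: sub_top hS.
exact: plf_top (uset_plf x).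
Qed.

Lemma beta_downI a b : beta (down (a `&` b)%O) = beta (down a) `&` beta (down b).
Proof.
apply/seteqP; split=> x.
  by move=> [c [cab xc]]; split; exists c; split=> //;
    apply: prec_ler cab _; rewrite ?leIl ?leIr.
move=> [[c [ca xc]] [e [eb xe]]]; exists (c `&` e)%O; split.
  by apply: (sub_meet hS); [apply: prec_lel ca|apply: prec_lel eb];
    rewrite ?leIl ?leIr.
exact: plf_meet (uset_plf x) _ _ xc xe.
Qed.

Lemma down_baseT : down_base setT.
Proof. by exists \top%O => //; exact: beta_downT. Qed.

Lemma down_baseI : setI_closed down_base.
Proof.
by move=> _ _ [a _ <-] [b _ <-]; exists (a `&` b)%O => //; exact: beta_downI.
Qed.

Definition down_topology : topology (Ul A) :=
  base_topology down_baseT down_baseI.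

Lemma prec_phi a b : prec a b <-> phi a `<=` beta (down b).
Proof.
split=> [ab x xa|]; first by exists a.
by move/(phi_sub_beta (down_ideal b)).
Qed.

Lemma beta_down_phi a : beta (down a) `<=` phi a.
Proof. by move=> x [c [/(S4_le hA) ca xc]]; exact: plf_up (uset_plf x) _ _ ca xc. Qed.

Lemma int_S_phi a : int_S down_topology (phi a) = beta (down a).
Proof.
have nbP := basis_nbhsP (base_topology_basis down_baseT down_baseI).
apply/seteqP; split=> x.
  move=> /nbP[_ [[b _ <-] [c [cb xc]] ba]].
  have [e ce eb] := S4_interp hA cb.
  exists c; split=> //; apply: prec_ler ce _.
  by apply/phi_sub/(subset_trans _ ba); exact/prec_phi.
move=> xa; apply/nbP; exists (beta (down a)); split=> //; first by exists a.
exact: beta_down_phi.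
Qed.

Lemma beta_open (I : set A) : open (beta I).
Proof.
have -> : beta I = \bigcup_(a in I) phi a.
  by apply/seteqP; split=> x [a]; [case|]; exists a.
by apply: bigcup_open => a _; exact: phi_open.
Qed.

(** Interpolation again: if [x] contains [b] with [prec b a], and [prec b c] and
    [prec c a], then [x] lies in the interior of [phi c], so that [c] belongs to
    [y]; and [prec c a] then puts [y] in the interior of [phi a]. *)
Lemma tri_S_le_S (x y : Ul A) :
  tri_S down_topology x y -> le_S down_topology x y.
Proof.
move=> xy _ /clopen_phi[a ->]; rewrite int_S_phi => -[b [ba xb]].
have [c bc ca] := S4_interp hA ba.
exists c; split=> //; apply: (xy (phi c)); first exact: phi_clopen.
by rewrite int_S_phi; exists b.
Qed.

Lemma down_baseE :
  [set int_S down_topology U | U in @clopen (Ul A)] = down_base.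
Proof.
apply/seteqP; split=> [_ [U cU <-]|_ [a _ <-]].
  have [a ->] := clopen_phi cU.
  by exists a => //; rewrite int_S_phi.
by exists (phi a); [exact: phi_clopen|exact: int_S_phi].
Qed.

Lemma down_topology_S4 : S4_subordination_space down_topology.
Proof.
split; [exact: stone_Ul| | |exact: tri_S_le_S].
  by rewrite down_baseE; exact: base_topology_basis.
by move=> _ /clopen_phi[a ->]; rewrite int_S_phi; exact: beta_open.
Qed.

Lemma prec_prec_S a b : prec a b <-> prec_S down_topology (phi a) (phi b).
Proof.
rewrite prec_phi -int_S_phi; split=> [ab|[]//].
by split=> //; exact: phi_clopen.
Qed.

End Subordination.

Theorem theorem9 (d : Order.disp_t) (A : ctbDistrLatticeType d)
    (prec : A -> A -> Prop) (hA : S4_subordination prec) :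
  let S : set (set (Ul A)) := [set beta (prec_down prec a) | a in [set: A]] in
  (forall F : set (set (Ul A)),
     finite_set F -> F `<=` S -> S (\bigcap_(U in F) U)) /\
  exists tauS : topology (Ul A),
    [/\ @basis (alt_space tauS) S,
        S4_subordination_space tauS &
        forall a b : A, prec a b <-> prec_S tauS (phi a) (phi b)].
Proof.
move=> S; split.
  exact: finite_bigcap_closed (down_baseT hA) (down_baseI hA).
exists (down_topology hA); split.
- exact: base_topology_basis.
- exact: down_topology_S4.
- exact: prec_prec_S.
Qed.
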